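(* Let $g\ge 3$ and $n\ge g+2$. Suppose $G$ is a connected graph of order $n$ with girth $g$ whose Sombor index $SO(G)$ is minimum among all connected graphs of order $n$ with girth $g$. Then $G$ is unicyclic and is isomorphic to the graph obtained from the cycle $C_g$ by attaching a single path of length $n-g$ at one vertex of the cycle (i.e. the unicyclic graph with cycle length $g$ having exactly one pendent path, of length at least two); in particular $SO(G)=\sqrt5+3\sqrt{13}+2\sqrt2\,(n-4)$.
   Context: For a graph $G$, $d_G(w)$ denotes the degree of vertex $w$, and the Sombor index is $SO(G)=\sum_{ab\in E(G)}\sqrt{d_G(a)^2+d_G(b)^2}$. The girth of a graph is the length of its shortest cycle. $C_g$ denotes the cycle on $g$ vertices. A pendent path in $G$ is a path $u u_1\cdots u_k$ ($k\ge1$) with $d_G(u)\ge 3$, $d_G(u_k)=1$ and $d_G(u_i)=2$ for $1\le i\le k-1$; $k$ is its length. *)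

(* Defs.v *)
From HB Require Import structures.
From mathcomp Require Import all_boot all_order all_algebra.
From mathcomp Require Import reals.
Set Implicit Arguments. Unset Strict Implicit. Unset Printing Implicit Defensive.
Import Order.TTheory GRing.Theory Num.Theory.

Section Graphs.
Variable n : nat.

Definition simple_graph (e : rel 'I_n) : Prop :=
  symmetric e /\ irreflexive e.

Definition connected_graph (e : rel 'I_n) : Prop :=
  forall x y : 'I_n, connect e x y.

Definition deg (e : rel 'I_n) (x : 'I_n) : nat := #|[pred y | e x y]|.

Definition edges (e : rel 'I_n) : {set 'I_n * 'I_n} :=
  [set p : 'I_n * 'I_n | (val p.1 < val p.2)%N && e p.1 p.2].

Definition has_cycle_of_length (e : rel 'I_n) (k : nat) : Prop :=
  exists s : seq 'I_n, [/\ size s = k, (3 <= k)%N, uniq s & cycle e s].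

Definition girth_is (e : rel 'I_n) (g : nat) : Prop :=
  has_cycle_of_length e g /\ forall k, (k < g)%N -> ~ has_cycle_of_length e k.

Definition sombor (R : realType) (e : rel 'I_n) : R :=
  \sum_(p in edges e)
     Num.sqrt (((deg e p.1)%:R : R) ^+ 2 + ((deg e p.2)%:R : R) ^+ 2).

(* Tadpole graph: cycle on vertices 0..g-1, plus a path 0 - g - (g+1) - ... - (n-1)
   attached at vertex 0. *)
Definition tadpole_adj0 (g a b : nat) : bool :=
  [|| (a < g) && (b < g) && (b == a.+1 %% g),
      (a == 0) && (b == g)
    | (g <= a) && (b == a.+1)]%N.

Definition tadpole (g : nat) : rel 'I_n :=
  fun x y => tadpole_adj0 g (val x) (val y) || tadpole_adj0 g (val y) (val x).

Definition isomorphic (e1 e2 : rel 'I_n) : Prop :=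
  exists f : 'I_n -> 'I_n, bijective f /\ forall x y, e1 x y = e2 (f x) (f y).

End Graphs.

(* Main.v *)
Require Import Defs.
From HB Require Import structures.
From mathcomp Require Import all_boot all_order all_algebra.
From mathcomp Require Import reals.
From mathcomp Require Import zify ring lra.
Import Order.TTheory GRing.Theory Num.Theory.
Local Open Scope ring_scope.

(** The bound is local. With [h d = d / sqrt 2] for [d >= 2] and [h 1 = sqrt 5 - sqrt 2],
    every edge that does not join two leaves satisfies [sqrt (a^2 + b^2) >= h a + h b], so
    [SO >= \sum_x d x * h (d x)]. The function [d * h d] lies above
    [2 sqrt 2 + (3 sqrt 2 - sqrt 5) (d - 2) + (sqrt 5 - sqrt 2 / 2) (d - 2)^+],
    and [\sum_x (d x - 2) >= 0] for a connected graph with a cycle. Hence a graph whose index is at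
    most that of the tadpole has [\sum_x (d x - 2)^+ <= 1]: it has [n] edges and at most one vertex
    of degree larger than 2, of degree 3. In such a graph, a shortest cycle followed by the path
    leaving it exhausts the vertices, and counting edges shows that there are no further ones. *)

(** * Arcs, degree sums and cycles in a connected graph *)

(** Each edge is two arcs, exchanged by swapping the endpoints; irreflexivity excludes the
    diagonal. *)
Lemma sum_arcs (V : nmodType) (n : nat) (e : rel 'I_n) (F : 'I_n -> 'I_n -> V) :
  simple_graph e -> (forall x y, F x y = F y x) ->
  \sum_x \sum_(y | e x y) F x y = (\sum_(p in edges e) F p.1 p.2) *+ 2.
Proof.
move=> [esym eirr] Fsym.
rewrite pair_big_dep /= (bigID (fun p : 'I_n * 'I_n => (p.1 < p.2)%N)) /= mulr2n.
congr (_ + _); first by apply: eq_bigl => p; rewrite inE andbC.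
pose sw (p : 'I_n * 'I_n) := (p.2, p.1).
have swK : involutive sw by case.
rewrite (reindex_inj (inv_inj swK)) /=; apply: eq_big => [[x y]|[x y] _] //=.
rewrite inE /= esym -leqNgt andbC leq_eqVlt; case: eqP => //= /val_inj ->.
by rewrite eirr andbF.
Qed.

Lemma sum_deg (n : nat) (e : rel 'I_n) :
  simple_graph e -> (\sum_x deg e x = #|edges e|.*2)%N.
Proof.
move=> he; have := sum_arcs nat n e (fun _ _ => 1%N) he (fun _ _ => erefl).
rewrite sum1_card mulr2n -[(_ + _)%R]/(_ + _)%N addnn => <-.
by apply: eq_bigr => x _; rewrite sum1_card.
Qed.

Lemma leq_size_deg (n : nat) (e : rel 'I_n) (x : 'I_n) (s : seq 'I_n) :
  uniq s -> all (e x) s -> (size s <= deg e x)%N.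
Proof.
move=> us /allP sx; rewrite -(card_uniqP us); apply: subset_leq_card.
by apply/subsetP => y /sx.
Qed.

(** Otherwise [A] would be closed under [e], and no path could lead from [a] to [b]. *)
Lemma connected_exit (n : nat) (e : rel 'I_n) (A : {pred 'I_n}) (a b : 'I_n) :
  simple_graph e -> connected_graph e -> a \in A -> b \notin A ->
  exists x y, [/\ x \in A, y \notin A & e x y].
Proof.
move=> [esym _] econ aA bA.
case: (boolP [exists x, exists y, [&& x \in A, y \notin A & e x y]]).
  by move=> /existsP[x /existsP[y /and3P[? ? ?]]]; exists x, y.
move=> /existsPn no_exit.
suff clA : closed e A by move: bA; rewrite -(closed_connect clA (econ a b)) aA.
apply: intro_closed; first exact: sym_connect_sym.
move=> x y exy xA; move: (no_exit x) => /existsPn/(_ y).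
by rewrite xA exy andbT negbK.
Qed.

(** Successor and predecessor on the cycle serve; they differ because the cycle has at least three
    vertices. *)
Lemma cycle_two_neighbours (n : nat) (e : rel 'I_n) (s : seq 'I_n) (x : 'I_n) :
  symmetric e -> (3 <= size s)%N -> uniq s -> cycle e s -> x \in s ->
  exists y z, [/\ y \in s, z \in s, y != z, e x y & e x z].
Proof.
move=> esym s3 us cs xs; exists (next s x), (prev s x).
rewrite mem_next mem_prev xs next_cycle // esym prev_cycle //; split=> //.
case: (rot_to xs) => i t rt.
rewrite -(next_rot i us) -(prev_rot i us) rt.
have : size (x :: t) = size s by rewrite -rt size_rot.
have : uniq (x :: t) by rewrite -rt rot_uniq.
case: t {rt} => [|y t]; first by move=> _ /=; lia.
case/lastP: t => [|t z]; first by move=> _ /=; lia.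
move=> /and3P[xn yn _] _; rewrite prev_nth mem_head memNindex //=.
rewrite eqxx size_rcons /= nth_rcons ltnn eqxx.
by apply: contraNneq yn => ->; rewrite mem_rcons mem_head.
Qed.

Lemma leq_sum_deg (n g : nat) (e : rel 'I_n) :
  simple_graph e -> connected_graph e -> has_cycle_of_length e g ->
  (n.*2 <= \sum_x deg e x)%N.
Proof.
move=> he econ [s [<- s3 us cs]]; have [esym eirr] := he.
pose arcs (A : {set 'I_n}) := [set p : 'I_n * 'I_n | [&& p.1 \in A, p.2 \in A & e p.1 p.2]].
(* By maximality a dense set containing the cycle is everything: attaching an outside neighbour
   adds one vertex and at least two arcs. *)
pose dense (A : {set 'I_n}) := (#|A|.*2 <= #|arcs A|)%N.
(* Each cycle vertex has two neighbours on the cycle, hence is the source of at least two arcs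
   inside it. *)
have dense_s : dense [set x in s].
  rewrite /dense -sum1_card -muln2 big_distrl -sum1_card /=.
  rewrite (eq_bigl (fun p : 'I_n * 'I_n => (p.1 \in s) && ((p.2 \in s) && e p.1 p.2))); last first.
    by move=> p; rewrite !inE.
  rewrite -(pair_big_dep (mem s) (fun x y => (y \in s) && e x y) (fun _ _ => 1%N)) /=.
  rewrite (eq_bigl (mem s)) => [|x]; last by rewrite inE.
  apply: leq_sum => x xs.
  have [y [z [ys zs yz xy xz]]] := cycle_two_neighbours _ _ _ _ esym s3 us cs xs.
  rewrite mul1n sum1_card -[2%N]/(true.+1) -yz -cards2 subset_leq_card //.
  by apply/subsetP => w; rewrite !inE => /orP[] /eqP->; apply/andP.
have [A /maxsetP[dA maxA] sA] := maxset_exists dense_s.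
suff AT : A = setT.
  move: dA; rewrite /dense AT cardsT card_ord => /leq_trans; apply.
  rewrite (eq_bigr (fun x => \sum_(y | e x y) 1)%N) => [|x _]; last by rewrite sum1_card.
  rewrite pair_big_dep -sum1_card /= leq_eqVlt; apply/orP; left; apply/eqP.
  by apply: eq_bigl => p; rewrite !inE.
apply/setP => b; rewrite inE; apply: contraT => bA.
have [a aA] : exists a, a \in A.
  case: s s3 {us cs dense_s} sA => // a s _ /subsetP/(_ a) aA.
  by exists a; apply: aA; rewrite !inE eqxx.
have [x [y [xA yA xy]]] := connected_exit _ _ _ _ _ he econ aA bA.
suff /maxA E : dense (y |: A) by move: yA; rewrite -(E (subsetUr _ _)) !inE eqxx.
apply: (leq_trans (n := #|(x, y) |: ((y, x) |: arcs A)|)).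
  rewrite !cardsU1 !inE /= (negbTE yA) !andbF !orbF xpair_eqE.
  have -> : (x == y) = false by apply/eqP => xy'; move: yA; rewrite -xy' xA.
  by move: dA; rewrite /dense /=; lia.
apply: subset_leq_card; apply/subsetP => -[u v]; rewrite !inE !xpair_eqE /=.
case/or3P => [/andP[/eqP-> /eqP->]|/andP[/eqP-> /eqP->]|/and3P[-> -> ->]].
- by rewrite xA eqxx xy orbT.
- by rewrite xA eqxx esym xy orbT.
- by rewrite !orbT.
Qed.

(** * The tadpole: connectedness, degrees and girth *)

Section Tadpole.
Variable g : nat.
Hypothesis g3 : (3 <= g)%N.

(* The tadpole has the edges [{i, tadpole_parent i}], each arising from exactly one vertex [i]. *)
Definition tadpole_parent (i : nat) : nat :=
  if i == 0%N then g.-1 else if i == g then 0%N else i.-1.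

Lemma tadpole_adj0E a b : tadpole_adj0 g a b = (a == tadpole_parent b).
Proof.
rewrite /tadpole_adj0 /tadpole_parent.
case: (ltngtP a.+1 g) => ag; last first.
- by rewrite ag modnn; repeat case: ifP; lia.
- by repeat case: ifP; lia.
- by rewrite modn_small //; repeat case: ifP; lia.
Qed.

(** This makes the edges [{i, tadpole_parent i}] pairwise distinct. It relies on [3 <= g]: for
    [g = 2], 0 and 1 would be parents of each other. *)
Lemma tadpole_parent_parent_neq i : tadpole_parent (tadpole_parent i) != i.
Proof. by rewrite /tadpole_parent; repeat case: ifP; lia. Qed.

Lemma tadpole_parent_lt i k : (g < k)%N -> (i < k)%N -> (tadpole_parent i < k)%N.
Proof. by rewrite /tadpole_parent; repeat case: ifP; lia. Qed.

Lemma tadpole_child i k : (g < k)%N -> (i.+1 < k)%N ->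
  exists2 c, (c < k)%N & tadpole_parent c = i.
Proof.
(* The parent of [g] is 0, so [g.-1] does not have [g] as a child; its child is 0, which closes the
   cycle. *)
move=> gk ik; exists (if i == g.-1 then 0%N else i.+1); first by case: ifP; lia.
by rewrite /tadpole_parent; repeat case: ifP; lia.
Qed.

Variable n : nat.
Hypothesis gn : (g + 2 <= n)%N.

(** The default of [insubd] is never reached, since parents stay below [n]. *)
Definition tadpole_parent_ord (x : 'I_n) : 'I_n := insubd x (tadpole_parent x).
Local Notation p := tadpole_parent_ord.

Lemma val_tadpole_parent_ord x : val (p x) = tadpole_parent x.
Proof.
rewrite val_insubd; case: ifP => //; have := ltn_ord x.
by rewrite /tadpole_parent; repeat case: ifP; lia.
Qed.

Lemma tadpole_valE (x y : 'I_n) :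
  tadpole g x y = (val x == tadpole_parent (val y)) || (val y == tadpole_parent (val x)).
Proof. by rewrite /tadpole !tadpole_adj0E. Qed.

Lemma tadpoleE (x y : 'I_n) : tadpole g x y = (x == p y) || (y == p x).
Proof. by rewrite tadpole_valE -!val_tadpole_parent_ord. Qed.

Lemma tadpole_parent_ord_asym x y : ~~ ((x == p y) && (y == p x)).
Proof.
apply/negP => /andP[/eqP xy /eqP yx]; have := tadpole_parent_parent_neq x.
by rewrite -!val_tadpole_parent_ord -yx -xy eqxx.
Qed.

Lemma tadpole_simple : simple_graph (@tadpole n g).
Proof.
split=> [x y|x]; first by rewrite !tadpoleE orbC.
by rewrite tadpoleE orbb; have := tadpole_parent_ord_asym x x; rewrite andbb => /negbTE.
Qed.

Lemma tadpole_connected : connected_graph (@tadpole n g).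
Proof.
have n0 : (0 < n)%N by lia.
have csym : connect_sym (@tadpole n g) by apply: sym_connect_sym; case: tadpole_simple.
(* Parents decrease in value except at 0, so descending along them ends at 0. *)
have root k (x : 'I_n) : (x <= k)%N -> connect (@tadpole n g) x (Ordinal n0).
  elim: k x => [|k IH] x xk; have [x0|x0] := eqVneq (val x) 0%N.
  - by rewrite (_ : x = Ordinal n0) ?connect0 //; apply: val_inj.
  - by move: x0 => /=; lia.
  - by rewrite (_ : x = Ordinal n0) ?connect0 //; apply: val_inj.
  apply: (connect_trans (y := p x)); first by rewrite connect1 // tadpoleE eqxx orbT.
  apply: IH; rewrite -[nat_of_ord _]/(val _) val_tadpole_parent_ord /tadpole_parent.
  by move: x0 => /=; repeat case: ifP; lia.
by move=> x y; apply: connect_trans (root _ x (leqnn _)) _; rewrite csym; apply: root (leqnn _).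
Qed.

(** Every arc has exactly one of the forms [(x, p x)] and [(p x, x)]; the arcs of the second form
    are regrouped by the child. *)
Lemma sum_tadpole_arcs (V : nmodType) (F : 'I_n -> 'I_n -> V) :
  \sum_x \sum_(y | tadpole g x y) F x y = \sum_x (F x (p x) + F (p x) x).
Proof.
rewrite big_split [in X in _ = _ + X]/=.
transitivity (\sum_x (F x (p x) + \sum_(y | x == p y) F x y)).
  apply: eq_bigr => x _; rewrite (bigD1 (p x)) /=; last by rewrite tadpoleE eqxx orbT.
  congr (_ + _); apply: eq_bigl => y; rewrite tadpoleE.
  have := tadpole_parent_ord_asym x y.
  by case: eqP => [->|_]; case: eqP; rewrite ?andbT ?andbF ?orbF.
rewrite big_split /=; congr (_ + _).
rewrite (exchange_big_dep predT) //=; apply: eq_bigr => y _.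
by rewrite big_pred1_eq.
Qed.

Lemma deg_tadpole (x : 'I_n) :
  deg (@tadpole n g) x = (1 + (val x != n.-1) + (val x == 0))%N.
Proof.
(* The degree is the arc sum of the indicator that the source is [x], so it counts one parent and
   all children. *)
have -> : deg (@tadpole n g) x = (\sum_u \sum_(v | tadpole g u v) (u == x))%N.
  rewrite (bigD1 x) //= [X in (_ + X)%N]big1 ?addn0.
    by rewrite eqxx sum1_card.
  by move=> u /negbTE ->; rewrite big1.
have n1 : (n.-1 < n)%N by lia.
have -> : (\sum_u \sum_(v | tadpole g u v) (u == x) = \sum_u ((u == x) + (p u == x)))%N.
  exact: sum_tadpole_arcs nat (fun u _ => (u == x : nat)).
rewrite big_split /=.
under [in X in (_ + X)%N]eq_bigr => u _.
  (* The children of [x] are its successor, or 0 when [x] closes the cycle, and in addition [g] when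
     [x] is 0. *)
  have -> : (p u == x : nat) = ((u == (if val x == g.-1 then 0 else x.+1) :> nat)
     + (val x == 0) && (u == g :> nat))%N.
    rewrite -val_eqE val_tadpole_parent_ord /tadpole_parent /=.
    by have := ltn_ord u; have := ltn_ord x; repeat case: ifP => //=; lia.
  over.
have sum_eq c : (\sum_(u < n) (u == c :> nat) = (c < n)%N)%N.
  case: (ltnP c n) => cn.
    rewrite (bigD1 (Ordinal cn)) //= eqxx big1 // => u.
    by rewrite -val_eqE /= => /negbTE ->.
  by rewrite big1 // => u _; have := ltn_ord u; case: eqP => //; lia.
rewrite big_split /= -[X in (X + _)%N]/(\sum_(u < n) (u == x :> nat))%N sum_eq.
rewrite sum_eq ltn_ord -addnA; congr (_ + _)%N; congr (_ + _)%N.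
  by have := ltn_ord x; case: ifP => /=; lia.
by case: (val x == 0%N); [rewrite /= sum_eq; lia|rewrite big1].
Qed.

(** A shorter cycle would lie among the first [g] vertices and be closed under taking parents, hence
    contain all [g] of them. *)
Lemma tadpole_girth : girth_is (@tadpole n g) g.
Proof.
have n0 : (0 < n)%N by lia.
have [tsym _] := tadpole_simple.
split.
  exists [seq insubd (Ordinal n0) i | i <- iota 0 g].
  have valK i : (i < n)%N -> val (insubd (Ordinal n0) i) = i.
    by move=> it; rewrite val_insubd it.
  split=> //.
  - by rewrite size_map size_iota.
  - rewrite map_inj_in_uniq ?iota_uniq // => i j; rewrite !mem_iota !add0n /= => ig jg.
    by move=> /(congr1 val); rewrite !valK //; lia.
  - have iotaE : iota 0 g = 0%N :: iota 1 g.-1 by case: (g) g3.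
    rewrite iotaE cycle_map /= rcons_path; apply/andP; split; last first.
      rewrite (last_nth 0%N) -iotaE size_iota nth_iota; last by lia.
      rewrite /= tadpole_valE !valK /tadpole_parent; try lia.
      by rewrite add0n !eqxx.
    apply/(pathP 0%N) => i; rewrite -iotaE size_iota => ig.
    rewrite !nth_iota; try lia.
    rewrite /= tadpole_valE !valK /tadpole_parent; try lia.
    by repeat case: ifP; lia.
move=> k kg [s [sk k3 us cs]]; rewrite -sk in k3.
have [x0 x0s] : exists x, x \in s by case: (s) k3 => // x; exists x; exact: mem_head.
have s_lt x : x \in s -> (x < g)%N.
  have [M Ms maxM] := arg_maxnP (fun i : 'I_n => val i) x0s.
  (* For a largest cycle vertex [M >= g], the only neighbour not above [M] is its parent, but two
     are required. *)
  suff Mg : (M < g)%N by move=> /maxM /= xM; apply: leq_ltn_trans xM Mg.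
  rewrite ltnNge; apply/negP => gM.
  have nbM y : y \in s -> tadpole g M y -> y = p M.
    move=> /maxM /= yM; rewrite tadpoleE => /orP[|/eqP //].
    rewrite -val_eqE val_tadpole_parent_ord /tadpole_parent /=.
    by repeat case: ifP; lia.
  have [y [z [ys zs yz /(nbM _ ys) yM /(nbM _ zs) zM]]] :=
    cycle_two_neighbours _ _ _ _ tsym k3 us cs Ms.
  by move: yz; rewrite yM zM eqxx.
(* Were both cycle neighbours children of [x], they would coincide: below [g] the parent map is
   injective. *)
have s_parent i : i \in map val s -> tadpole_parent i \in map val s.
  move=> /mapP[x xs ->]; rewrite -val_tadpole_parent_ord.
  have [y [z [ys zs yz]]] := cycle_two_neighbours _ _ _ _ tsym k3 us cs xs.
  rewrite !tadpoleE => /orP[/eqP xy|/eqP <-]; last by rewrite map_f.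
  move=> /orP[/eqP xz|/eqP <-]; last by rewrite map_f.
  case/eqP: yz; apply: val_inj; move: (xy); rewrite xz => /(congr1 val).
  rewrite !val_tadpole_parent_ord /tadpole_parent /=.
  by have := s_lt _ ys; have := s_lt _ zs; repeat case: ifP; lia.
have s_pred i : (i < g)%N -> i.+1 \in map val s -> i \in map val s.
  move=> ig /s_parent; rewrite /tadpole_parent /=; case: ifP => // /eqP ig1.
  by move=> /s_parent; rewrite /tadpole_parent -ig1.
have s_down i d : (i + d < g)%N -> (i + d)%N \in map val s -> i \in map val s.
  elim: d => [|d IH]; first by rewrite addn0.
  by rewrite addnS => idg /(s_pred _ (ltnW idg)); apply: IH; exact: ltnW.
(* Descending from [x0] reaches 0; the parent of 0 is [g.-1], and descending from there reaches
   everything below [g]. *)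
have s_0 : 0%N \in map val s by apply: (s_down 0%N x0); [exact: s_lt|exact: map_f].
have : {subset iota 0 g <= map val s}.
  move=> i; rewrite mem_iota add0n => /= ig.
  apply: (s_down i (g.-1 - i)%N); first by lia.
  by rewrite subnKC; [exact: s_parent s_0|lia].
by move=> /(uniq_leq_size (iota_uniq 0 g)); rewrite size_iota size_map sk; lia.
Qed.
End Tadpole.

(** * The charging bound on the Sombor index *)

(** An edge joining two leaves would be a whole component, but a third vertex exists. *)
Lemma edge_deg_gt1 (n : nat) (e : rel 'I_n) (x y : 'I_n) :
  simple_graph e -> connected_graph e -> (2 < n)%N -> e x y ->
  (1 < deg e x)%N || (1 < deg e y)%N.
Proof.
move=> he econ n3 xy; have [esym eirr] := he.
have [b] : exists b, b \notin [set x; y].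
  apply/existsP; apply: contraLR n3; rewrite negb_exists => /forallP allxy.
  have : [set: 'I_n] \subset [set x; y] by apply/subsetP => z _; have := allxy z; rewrite negbK.
  by move/subset_leq_card; rewrite cardsT card_ord cards2 -leqNgt => /leq_trans; apply; case: (x != y).
move=> bxy; have [u [v [uxy vxy uv]]] := connected_exit _ _ [set x; y] _ _ he econ (set21 x y) bxy.
move: vxy; rewrite !inE negb_or => /andP[vx vy].
move: uxy uv; rewrite !inE => /orP[] /eqP-> uv; apply/orP; [left|right].
- by apply: (leq_size_deg _ _ _ [:: y; v]); rewrite /= ?inE 1?eq_sym ?vy ?xy ?uv.
- by apply: (leq_size_deg _ _ _ [:: x; v]); rewrite /= ?inE 1?eq_sym ?vx 1?esym ?xy ?uv.
Qed.

Lemma deg_gt0 (n : nat) (e : rel 'I_n) (x : 'I_n) :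
  simple_graph e -> connected_graph e -> (1 < n)%N -> (0 < deg e x)%N.
Proof.
move=> he econ n2.
have [b] : exists b, b \notin [set x].
  apply/existsP; apply: contraLR n2; rewrite negb_exists => /forallP allx.
  have : [set: 'I_n] \subset [set x] by apply/subsetP => z _; have := allx z; rewrite negbK.
  by move/subset_leq_card; rewrite cardsT card_ord cards1 -leqNgt.
move=> bx; have [u [v [/set1P -> _ xv]]] := connected_exit _ _ [set x] _ _ he econ (set11 x) bx.
by apply: (leq_size_deg _ _ _ [:: v]); rewrite //= xv.
Qed.

Section Bounds.
Variable R : realType.

Lemma ler_sqrtr_sqr (x y : R) : 0 <= x -> x ^+ 2 <= y -> x <= Num.sqrt y.
Proof. by move=> x0 xy; rewrite -(ger0_norm x0) -sqrtr_sqr ler_wsqrtr. Qed.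

(* The function [h] of the header; the value at [d = 0] is junk. *)
Definition charge (d : nat) : R :=
  if (d <= 1)%N then Num.sqrt 5 - Num.sqrt 2 else d%:R * (Num.sqrt 2 / 2).

(** Equality holds for equal degrees at least 2 and for a leaf next to a vertex of degree 2, the
    latter fixing the value of [charge 1]. For two leaves the inequality fails. *)
Lemma edge_charge (a b : nat) : (0 < a)%N -> (0 < b)%N -> (1 < a)%N || (1 < b)%N ->
  charge a + charge b <= Num.sqrt (a%:R ^+ 2 + b%:R ^+ 2).
Proof.
wlog ab : a b / (a <= b)%N.
  move=> H; case: (leqP a b) => [|/ltnW] ab a0 b0 gt1; first exact: H.
  by rewrite addrC [X in Num.sqrt X]addrC H // orbC.
move=> a0 b0 gt1; have b1 : (1 < b)%N by move: gt1; case/orP => //; lia.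
rewrite /charge [(b <= 1)%N]leqNgt b1 /=.
have s2 : Num.sqrt (2 : R) ^+ 2 = 2 by rewrite sqr_sqrtr.
have s5 : Num.sqrt (5 : R) ^+ 2 = 5 by rewrite sqr_sqrtr.
have s2p : 0 <= Num.sqrt (2 : R) by exact: sqrtr_ge0.
have s5p : 0 <= Num.sqrt (5 : R) by exact: sqrtr_ge0.
have b2 : (2 : R) <= b%:R by rewrite (ler_nat _ 2%N).
move: s2 s5 s2p s5p b2; set s := Num.sqrt 2; set t := Num.sqrt 5; set y := b%:R.
case: (leqP a 1) => a1 s2 s5 s0 t0 b2.
  have -> : a = 1%N by lia.
  have ts : t * s <= 4 by have := sqr_ge0 (t - s); nra.
  have st : s <= t by rewrite -ler_sqr ?nnegrE // s2 s5; lra.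
  have tsy : t * s * (y - 2) <= 4 * (y - 2) by rewrite ler_wpM2r // subr_ge0.
  apply: ler_sqrtr_sqr.
    by rewrite addr_ge0 ?subr_ge0 // mulr_ge0 // divr_ge0.
  (* With [u = y - 2] the target [1 + y^2] is [5 + 4 u + u^2], so [t * s <= 4] lets the terms be
     compared one by one. *)
  have -> : (t - s + y * (s / 2)) ^+ 2 = t^+2 + t * s * (y - 2) + s^+2 * (y - 2)^+2 / 4 by field.
  by rewrite s2 s5; nra.
have a2 : (2 : R) <= a%:R by rewrite (ler_nat _ 2%N).
move: a2; set x := a%:R => a2.
apply: ler_sqrtr_sqr; first by nra.
have -> : (x * (s / 2) + y * (s / 2)) ^+ 2 = s ^+ 2 * (x + y) ^+ 2 / 4 by field.
by rewrite s2; have := sqr_ge0 (x - y); nra.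
Qed.

(** The left side interpolates [d * charge d] at 1, 2 and 3, with the truncated subtraction [d - 2]
    supplying the kink at 2. From 2 on, the difference is a positive multiple of [(d - 2) (d - 3)],
    nonnegative at integers. *)
Lemma charge_ge (d : nat) : (0 < d)%N ->
  2 * Num.sqrt 2 + (3 * Num.sqrt 2 - Num.sqrt 5) * (d%:R - 2)
    + (Num.sqrt 5 - Num.sqrt 2 / 2) * (d - 2)%:R <= d%:R * charge d.
Proof.
have s2 : Num.sqrt (2 : R) ^+ 2 = 2 by rewrite sqr_sqrtr.
have s2p : 0 <= Num.sqrt (2 : R) by exact: sqrtr_ge0.
move: s2 s2p; set s := Num.sqrt 2; set t := Num.sqrt 5 => s2 s0 d0.
rewrite /charge; case: (leqP d 1) => d1.
  have -> : d = 1%N by lia.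
  by rewrite (_ : (1 - 2)%N = 0%N) // -/s -/t; lra.
rewrite natrB // -/s -/t.
have [->|d2] := eqVneq d 2%N; first by lra.
have : (3 : R) <= d%:R by rewrite (ler_nat _ 3%N); lia.
set x := d%:R => x3; rewrite -subr_ge0.
have -> : x * (x * (s / 2)) - (2 * s + (3 * s - t) * (x - 2) + (t - s / 2) * (x - 2))
  = s / 2 * ((x - 2) * (x - 3)) by field.
by rewrite !mulr_ge0 ?divr_ge0 ?subr_ge0 //; lra.
Qed.

(** Summed over arcs, [edge_charge] bounds twice the index by twice the sum of degree times charge,
    to which [charge_ge] applies vertex by vertex. *)
Lemma sombor_ge (n : nat) (e : rel 'I_n) :
  simple_graph e -> connected_graph e -> (2 < n)%N ->
  2 * Num.sqrt 2 * n%:R + (3 * Num.sqrt 2 - Num.sqrt 5) * ((\sum_x deg e x)%:R - 2 * n%:R)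
    + (Num.sqrt 5 - Num.sqrt 2 / 2) * (\sum_x (deg e x - 2))%:R <= sombor R e.
Proof.
move=> he econ n3; have [esym _] := he.
have dgt0 x : (0 < deg e x)%N by apply: deg_gt0 => //; lia.
pose f x y : R := Num.sqrt ((deg e x)%:R ^+ 2 + (deg e y)%:R ^+ 2).
have fsym x y : f x y = f y x by rewrite /f addrC.
have so2 : \sum_x \sum_(y | e x y) f x y = sombor R e *+ 2 by exact: sum_arcs.
pose h x := charge (deg e x).
have : \sum_x \sum_(y | e x y) (h x + h y) <= \sum_x \sum_(y | e x y) f x y.
  apply: ler_sum => x _; apply: ler_sum => y xy.
  by apply: edge_charge => //; exact: edge_deg_gt1 xy.
rewrite so2.
have sumh : \sum_x \sum_(y | e x y) h x = \sum_x (deg e x)%:R * h x.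
  by apply: eq_bigr => x _; rewrite sumr_const mulr_natl.
have -> : \sum_x \sum_(y | e x y) (h x + h y) = (\sum_x (deg e x)%:R * h x) *+ 2.
  rewrite mulr2n -{1}sumh (eq_bigr (fun x => \sum_(y | e x y) h x + \sum_(y | e x y) h y)).
    rewrite big_split /= -sumh; congr (_ + _).
    rewrite (exchange_big_dep predT) //=; apply: eq_bigr => x _.
    by apply: eq_bigl => y; rewrite esym.
  by move=> x _; rewrite big_split.
rewrite lerMn2r /=; apply: le_trans.
have : \sum_(x < n) (2 * Num.sqrt 2 + (3 * Num.sqrt 2 - Num.sqrt 5) * ((deg e x)%:R - 2)
    + (Num.sqrt 5 - Num.sqrt 2 / 2) * (deg e x - 2)%:R) <= \sum_x (deg e x)%:R * h x.
  by apply: ler_sum => x _; apply: charge_ge.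
apply: le_trans; rewrite !big_split /= -!mulr_sumr sumrB !sumr_const card_ord -!natr_sum.
rewrite -[Num.sqrt 2 *+ n]mulr_natr -[2 *+ n]mulr_natr; move: (\sum_i deg e i)%N (\sum_i _)%N => D E.
by move: (Num.sqrt 2) (Num.sqrt 5) (D%:R : R) (E%:R : R) (n%:R : R) => s t D1 E1 N; lra.
Qed.

(** An excess of at least 2 would put the bound of [sombor_ge] above the assumed one by at least
    [sqrt 5 + 7 sqrt 2 - 3 sqrt 13 > 0]. *)
Lemma excess_le1 (n : nat) (e : rel 'I_n) :
  simple_graph e -> connected_graph e -> (4 < n)%N -> (n.*2 <= \sum_x deg e x)%N ->
  sombor R e <= Num.sqrt 5 + 3 * Num.sqrt 13 + 2 * Num.sqrt 2 * (n - 4)%:R ->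
  (\sum_x (deg e x - 2) <= 1)%N.
Proof.
move=> he econ n4 ndeg so; rewrite leqNgt; apply/negP => ex2.
have := le_trans (sombor_ge _ _ he econ (ltnW (ltnW n4))) so.
move: ndeg; rewrite -(ler_nat R) -mul2n natrM; move: ex2; rewrite -(ler_nat R).
rewrite natrB; last exact: ltnW.
move: (\sum_x deg e x)%N (\sum_x _)%N => D0 E0; move: (D0%:R : R) (E0%:R : R) (n%:R : R) => D E N.
have s2 : Num.sqrt (2 : R) ^+ 2 = 2 by rewrite sqr_sqrtr.
have s5 : Num.sqrt (5 : R) ^+ 2 = 5 by rewrite sqr_sqrtr.
have s13 : Num.sqrt (13 : R) ^+ 2 = 13 by rewrite sqr_sqrtr.
have s2p : 0 <= Num.sqrt (2 : R) by exact: sqrtr_ge0.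
have s5p : 0 <= Num.sqrt (5 : R) by exact: sqrtr_ge0.
have s13p : 0 <= Num.sqrt (13 : R) by exact: sqrtr_ge0.
move: s2 s5 s13 s2p s5p s13p.
set s := Num.sqrt 2; set t := Num.sqrt 5; set w := Num.sqrt 13.
move=> s2 s5 s13 s0 t0 w0 E2 DN.
(* These decimal bounds make the gap at least [2.2 + 9.8 - 11.1] and both slopes nonnegative. *)
have sl : 14/10 <= s by nra.
have tl : 22/10 <= t by nra.
have tu : t <= 23/10 by nra.
have su : s <= 15/10 by nra.
have wu : w <= 37/10 by nra.
have p1 : 0 <= (3 * s - t) * (D - 2 * N) by apply: mulr_ge0; lra.
have p2 : 0 <= (t - s / 2) * (E - 2) by apply: mulr_ge0; lra.
lra.
Qed.

End Bounds.

(** * The index of the tadpole and its invariance under isomorphism *)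

Lemma sum_deg_tadpole (n g : nat) (g3 : (3 <= g)%N) (gn : (g + 2 <= n)%N) :
  (\sum_x deg (@tadpole n g) x = n.*2)%N.
Proof.
rewrite (eq_bigr (fun x => \sum_(y | tadpole g x y) 1)%N) => [|x _].
  rewrite (sum_tadpole_arcs g g3 n gn nat (fun _ _ => 1%N)).
  by rewrite sum_nat_const card_ord muln2.
by rewrite sum1_card.
Qed.

Lemma sombor_tadpole (R : realType) (n g : nat) : (3 <= g)%N -> (g + 2 <= n)%N ->
  sombor R (@tadpole n g)
    = Num.sqrt 5 + 3 * Num.sqrt 13 + 2 * Num.sqrt 2 * (n - 4)%N%:R.
Proof.
move=> g3 gn; set e := @tadpole n g.
pose f x y : R := Num.sqrt ((deg e x)%:R ^+ 2 + (deg e y)%:R ^+ 2).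
have fsym x y : f x y = f y x by rewrite /f addrC.
have := sum_arcs R n e f (tadpole_simple g g3 n gn) fsym.
rewrite -[X in _ = X *+ 2]/(sombor R e).
rewrite sum_tadpole_arcs //; pose p := tadpole_parent_ord g n.
rewrite (eq_bigr (fun x => f x (p x) *+ 2)) => [|x _]; last by rewrite mulr2n [f (p x) x]fsym.
rewrite sumrMnl => /(pmulrnI (n := 2) isT) <-.
pose s : R := Num.sqrt 2; pose t : R := Num.sqrt 5; pose w : R := Num.sqrt 13.
have sqrt8 : Num.sqrt (2 ^+ 2 + 2 ^+ 2 : R) = 2 * s.
  have -> : 2 ^+ 2 + 2 ^+ 2 = 2 ^+ 2 * 2 :> R by ring.
  by rewrite sqrtrM ?exprn_ge0 // sqrtr_sqr ger0_norm.
have sqrt13 : Num.sqrt (3 ^+ 2 + 2 ^+ 2 : R) = w by congr Num.sqrt; ring.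
have sqrt13' : Num.sqrt (2 ^+ 2 + 3 ^+ 2 : R) = w by rewrite addrC.
have sqrt5 : Num.sqrt (1 ^+ 2 + 2 ^+ 2 : R) = t by congr Num.sqrt; ring.
pose F (c : nat) (a : R) (x : 'I_n) := if x == c :> nat then a else 0.
have sumF c a : (c < n)%N -> \sum_x F c a x = a.
  move=> cn; rewrite (bigD1 (Ordinal cn)) //= {1}/F eqxx big1 ?addr0 // => x.
  by rewrite /F -val_eqE /= => /negbTE ->.
(* The edge from [x] to its parent joins degrees 2 and 2, except that 0, 1 and [g] give the three
   edges at the branch vertex 0, of degrees 3 and 2, and [n.-1] gives the edge of the leaf. These
   cases are disjoint because [g < n.-1]. *)
transitivity (\sum_(x < n) (2 * s + F 0%N (w - 2 * s) x + F 1%N (w - 2 * s) x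
   + F g (w - 2 * s) x + F n.-1 (t - 2 * s) x)).
  apply: eq_bigr => x _; rewrite /f !deg_tadpole // val_tadpole_parent_ord //.
  rewrite /F /tadpole_parent; have := ltn_ord x.
  rewrite -![nat_of_ord x]/(val x); move: (val x) => k kn.
  have [->|k0] := eqVneq k 0%N.
    have -> : (0%N == n.-1) = false by lia.
    have -> : (0%N == 1%N) = false by lia.
    have -> : (0%N == g) = false by lia.
    have -> : (g.-1 == n.-1) = false by lia.
    have -> : (g.-1 == 0%N) = false by lia.
    by rewrite /= sqrt13; ring.
  have [->|k1] := eqVneq k 1%N.
    have -> : (1%N == n.-1) = false by lia.
    have -> : (1%N == g) = false by lia.
    have -> : (0%N == n.-1) = false by lia.
    by rewrite /= sqrt13'; ring.
  have [->|kg] := eqVneq k g.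
    have -> : (g == n.-1) = false by lia.
    have -> : (0%N == n.-1) = false by lia.
    by rewrite /= sqrt13'; ring.
  have -> : (k.-1 == 0%N) = false by lia.
  have -> : (k.-1 == n.-1) = false by lia.
  by case: (k == n.-1); rewrite /= ?sqrt5 ?sqrt8; ring.
rewrite !big_split /= !sumF; try lia.
rewrite sumr_const card_ord -[_ *+ n]mulr_natr natrB; last by lia.
by rewrite -/s -/t -/w; ring.
Qed.

(** [f] injects the arcs of [e1] into those of [e2]; as the latter are no more numerous, the
    injection is onto. *)
Lemma hom_arcs_eq (n : nat) (e1 e2 : rel 'I_n) (f : 'I_n -> 'I_n) :
  injective f -> (forall x y, e1 x y -> e2 (f x) (f y)) ->
  (\sum_x deg e2 x <= \sum_x deg e1 x)%N -> forall x y, e1 x y = e2 (f x) (f y).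
Proof.
move=> finj hom le21 x y.
have sum_degE (e : rel 'I_n) : (\sum_x deg e x = #|[set p : 'I_n * 'I_n | e p.1 p.2]|)%N.
  rewrite (eq_bigr (fun x => \sum_(y | e x y) 1)%N) => [|u _]; last by rewrite sum1_card.
  by rewrite pair_big_dep -sum1_card /=; apply: eq_bigl => p; rewrite inE.
pose ff (p : 'I_n * 'I_n) := (f p.1, f p.2).
have ffinj : injective ff by move=> [a b] [c d] [/finj -> /finj ->].
have sub : ff @: [set p | e1 p.1 p.2] \subset [set p | e2 p.1 p.2].
  by apply/subsetP => _ /imsetP[p pe ->]; move: pe; rewrite !inE; exact: hom.
have /eqP/setP/(_ (ff (x, y))) : ff @: [set p | e1 p.1 p.2] == [set p | e2 p.1 p.2].
  by rewrite eqEcard sub card_imset // -!sum_degE.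
by rewrite mem_imset // !inE.
Qed.

Lemma sombor_isomorphic (R : realType) (n : nat) (e1 e2 : rel 'I_n) :
  simple_graph e1 -> simple_graph e2 -> isomorphic e1 e2 -> sombor R e1 = sombor R e2.
Proof.
move=> h1 h2 [f [fbij fe]]; have finj := bij_inj fbij.
have degf x : deg e1 x = deg e2 (f x).
  rewrite /deg -!sum1_card /= [RHS](reindex f) /=; first by apply: eq_bigl => y; rewrite !inE fe.
  exact: onW_bij.
pose F (e : rel 'I_n) x y : R := Num.sqrt ((deg e x)%:R ^+ 2 + (deg e y)%:R ^+ 2).
have Fsym e x y : F e x y = F e y x by rewrite /F addrC.
apply: (pmulrnI (n := 2) isT).
rewrite -[LHS](sum_arcs R n e1 (F e1)) // -[RHS](sum_arcs R n e2 (F e2)) //.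
rewrite [RHS](reindex f) /=; last exact: onW_bij.
apply: eq_bigr => x _; rewrite [RHS](reindex f) /=; last exact: onW_bij.
by apply: eq_big => [y|y _]; rewrite ?fe // /F !degf.
Qed.

(** * Spanning tadpoles and the extremal graph *)

Lemma notin_seq (n : nat) (l : seq 'I_n) : (size l < n)%N -> exists b, b \notin l.
Proof.
move=> ln; apply/existsP; apply: contraLR ln; rewrite negb_exists => /forallP allx.
rewrite -leqNgt -{1}(card_ord n) cardE uniq_leq_size ?enum_uniq // => z _.
by have := allx z; rewrite negbK.
Qed.

(* A vertex of [t] other than the last one already has degree 2 inside [t], and degree 3 at
   position 0, so an edge leaving [t] must start from the last vertex. *)
Lemma tadpole_extend (n g : nat) (e : rel 'I_n) (x0 : 'I_n) (t : seq 'I_n) :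
  simple_graph e -> connected_graph e -> (3 <= g)%N ->
  (forall x, deg e x <= 3)%N ->
  (forall x y, 3 <= deg e x -> 3 <= deg e y -> x = y)%N ->
  (g < size t)%N -> (size t < n)%N -> uniq t ->
  (forall i, (i < size t)%N -> e (nth x0 t i) (nth x0 t (tadpole_parent g i))) ->
  exists2 y, uniq (rcons t y) & forall i, (i < size (rcons t y))%N ->
    e (nth x0 (rcons t y) i) (nth x0 (rcons t y) (tadpole_parent g i)).
Proof.
move=> he econ g3 deg3 deg3_uniq gk kn ut te; have [esym _] := he.
have [c ct] := notin_seq _ t kn.
have size_t : (0 < size t)%N by apply: leq_trans gk.
have [x [y [xt yt xy]]] := connected_exit _ _ (mem t) _ _ he econ (mem_nth x0 size_t) ct.
pose adj i j := (i == tadpole_parent g j) || (j == tadpole_parent g i).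
(* Distinct tadpole neighbours of position [i] within [t] bound the degree from below, strictly so
   if [y], which lies outside [t], is a neighbour too. *)
have deg_t i l : (i < size t)%N -> uniq l -> all (fun j => (j < size t) && adj i j)%N l ->
    (size l <= deg e (nth x0 t i) /\ (e (nth x0 t i) y -> size l < deg e (nth x0 t i)))%N.
  move=> it ul /allP al.
  have ul' : uniq [seq nth x0 t j | j <- l].
    rewrite map_inj_in_uniq // => j j' /al/andP[jt _] /al/andP[jt' _] /eqP.
    by rewrite nth_uniq // => /eqP.
  have el' : all (e (nth x0 t i)) [seq nth x0 t j | j <- l].
    apply/allP => _ /mapP[j /al /andP[jt /orP[]/eqP ij] ->].
      by rewrite esym ij; apply: te.
    by rewrite ij; apply: te.
  split=> [|ey]; first by rewrite -(size_map (nth x0 t)); apply: leq_size_deg.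
  rewrite -(size_map (nth x0 t)) -[_.+1]/(size (y :: _)); apply: leq_size_deg.
    rewrite /= ul' andbT; apply: contra yt => /mapP[j /al/andP[jt _] ->].
    exact: mem_nth.
  by rewrite /= ey.
have nb0 : all (fun j => (j < size t) && adj 0%N j)%N [:: g.-1; 1; g]%N.
  have p0 : tadpole_parent g 0%N = g.-1 by [].
  have p1 : tadpole_parent g 1%N = 0%N by rewrite /tadpole_parent /=; case: ifP.
  have pg : tadpole_parent g g = 0%N by rewrite /tadpole_parent eqxx; case: ifP; lia.
  rewrite /= /adj p0 p1 pg !eqxx gk orbT /= !andbT.
  by apply/andP; split; apply: leq_ltn_trans gk; lia.
have unb0 : uniq [:: g.-1; 1; g]%N by rewrite /= !inE; lia.
have [deg0 deg0y] := deg_t 0%N _ size_t unb0 nb0.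
have xi : x = nth x0 t (index x t) by rewrite nth_index.
have ik : (index x t < size t)%N by rewrite index_mem.
move: (index x t) xi ik => i xi ik; rewrite {x xt}xi in xy.
have i_last : i = (size t).-1.
  apply/eqP; apply: contraT => i_notlast.
  have i0 : i != 0%N by apply: contraTneq (deg3 (nth x0 t 0)) => i0; rewrite -ltnNge deg0y // -i0.
  have [|c' c'k c'i] := tadpole_child g g3 i _ gk; first by lia.
  have nbi : all (fun j => (j < size t) && adj i j)%N [:: tadpole_parent g i; c'].
    by rewrite /= /adj c'i !eqxx orbT c'k tadpole_parent_lt.
  have unbi : uniq [:: tadpole_parent g i; c'] by rewrite /= inE -c'i tadpole_parent_parent_neq.
  have [_ /(_ xy) degi] := deg_t i _ ik unbi nbi.
  move: (deg3_uniq _ _ degi deg0) => /eqP; rewrite nth_uniq // => i_0.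
  by rewrite i_0 in i0.
exists y; first by rewrite rcons_uniq yt ut.
move=> j; rewrite size_rcons ltnS leq_eqVlt => /orP[/eqP->|jt].
  have -> : tadpole_parent g (size t) = i.
    by rewrite i_last /tadpole_parent (gtn_eqF size_t) (gtn_eqF gk).
  by rewrite !nth_rcons ltnn eqxx ik esym.
by rewrite !nth_rcons jt tadpole_parent_lt // te.
Qed.

(** The cycle is rotated to start at a vertex with a neighbour off the cycle. Appending that
    neighbour gives a tadpole on [g.+1] vertices, which [tadpole_extend] then lengthens one vertex
    at a time. *)
Lemma spanning_tadpole (n g : nat) (e : rel 'I_n) :
  simple_graph e -> connected_graph e -> (g < n)%N -> has_cycle_of_length e g ->
  (forall x, deg e x <= 3)%N ->
  (forall x y, 3 <= deg e x -> 3 <= deg e y -> x = y)%N ->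
  exists x0 t, [/\ size t = n, uniq t &
    forall i, (i < n)%N -> e (nth x0 t i) (nth x0 t (tadpole_parent g i))].
Proof.
move=> he econ gn [s [sg g3 us cs]] deg3 deg3_uniq; have [esym _] := he.
have [b bs] : exists b, b \notin s by apply: notin_seq; rewrite sg.
have [a as_] : exists a, a \in s.
  by case: (s) sg g3 => [|c ?] => [<-|] //; exists c; exact: mem_head.
have [x0 [v [x0s vs x0v]]] := connected_exit _ _ (mem s) _ _ he econ as_ bs.
have [r s' rs] := rot_to x0s.
exists x0.
pose good t := uniq t /\ forall i, (i < size t)%N -> e (nth x0 t i) (nth x0 t (tadpole_parent g i)).
suff step d : (g.+1 + d <= n)%N -> exists2 t, size t = (g.+1 + d)%N & good t.
  have [|t] := step (n - g.+1)%N; rewrite subnKC // => tn [ut te].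
  by exists t; split=> // i i_n; apply: te; rewrite tn.
elim: d => [_|d IH gd].
  exists (rcons (x0 :: s') v); first by rewrite size_rcons -rs size_rot sg addn0.
  have sz : size (x0 :: s') = g by rewrite -rs size_rot.
  split; first by rewrite rcons_uniq -rs mem_rot rot_uniq us vs.
  have : cycle e (x0 :: s') by rewrite -rs rot_cycle.
  move=> /(pathP x0); rewrite size_rcons => cyc i.
  rewrite size_rcons sz ltnS leq_eqVlt /tadpole_parent => /orP[/eqP->|ig].
    have -> : (g == 0%N) = false by lia.
    by rewrite eqxx !nth_rcons sz ltnn eqxx (ltn_trans _ g3) //= esym.
  (* Position 0 has parent [g.-1]: this is the edge closing the cycle. *)
  have [->|i0] := eqVneq i 0%N.
    rewrite !nth_rcons sz (ltn_trans _ g3) // ifT; last by lia.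
    have := cyc g.-1; rewrite -/(size (x0 :: s')) sz => /(_ _)/=.
    move=> /(_ ltac:(lia)).
    rewrite -rcons_cons !nth_rcons sz ifT; last by lia.
    by move: sz => /= sz; rewrite ifF ?ifT; [rewrite esym|lia|lia].
  have -> : (i == g) = false by lia.
  rewrite !nth_rcons sz ig ifT; last by lia.
  have := cyc i.-1; move: sz => /= sz; rewrite sz => /(_ ltac:(lia)).
  rewrite -rcons_cons !nth_rcons /= sz ifT; last by lia.
  rewrite ifT; last by lia.
  by rewrite esym; case: (i) i0.
have [t tk [ut te]] := IH ltac:(lia).
have [||y uy ye] := tadpole_extend n g e x0 t he econ g3 deg3 deg3_uniq _ _ ut te.
- by rewrite tk leq_addr.
- by rewrite tk -addnS.
by exists (rcons t y) => //; rewrite size_rcons tk addnS.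
Qed.

Theorem theorem2p3 (R : realType) (g n : nat) (e : rel 'I_n)
  (hg : (3 <= g)%N) (hn : (g + 2 <= n)%N)
  (hsimp : simple_graph e) (hconn : connected_graph e) (hgirth : girth_is e g)
  (hmin : forall e' : rel 'I_n, simple_graph e' -> connected_graph e' ->
            girth_is e' g -> sombor R e <= sombor R e') :
  #|edges e| = n /\
  isomorphic e (@tadpole n g) /\
  sombor R e = Num.sqrt 5 + 3 * Num.sqrt 13 + 2 * Num.sqrt 2 * (n - 4)%N%:R.
Proof.
have tsimp := tadpole_simple g hg n hn.
have [cyc_g _] := hgirth.
have ge2n := leq_sum_deg _ _ _ hsimp hconn cyc_g.
have so_le : sombor R e <= sombor R (@tadpole n g).
  by apply: hmin => //; [exact: tadpole_connected|exact: tadpole_girth].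
rewrite sombor_tadpole // in so_le.
have ex1 : (\sum_x (deg e x - 2) <= 1)%N by apply: excess_le1 so_le => //; lia.
(* The sum is at least [2 n], at most [2 n + 1], and even. *)
have deg2n : (\sum_x deg e x = n.*2)%N.
  have : (\sum_x deg e x <= \sum_(x < n) (2 + (deg e x - 2)))%N by apply: leq_sum => x _; lia.
  rewrite big_split sum_nat_const card_ord /= => le2.
  move: le2 ge2n ex1 (sum_deg _ _ hsimp).
  by move: (\sum_x deg e x)%N (\sum_x (deg e x - 2))%N => D E; lia.
have mn : #|edges e| = n by have := sum_deg _ _ hsimp; rewrite deg2n; lia.
(* A vertex of degree 4, or two of degree 3, would already contribute an excess of 2. *)
have deg3 x : (deg e x <= 3)%N.
  by move: ex1; rewrite (bigD1 x) //=; lia.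
have deg3_uniq x y : (3 <= deg e x -> 3 <= deg e y -> x = y)%N.
  move=> dx dy; apply/eqP; apply: contraTT ex1 => xy.
  by rewrite (bigD1 x) // (bigD1 y) 1?eq_sym //= -ltnNge; lia.
have gn : (g < n)%N by lia.
have [x0 [t [tn ut te]]] := spanning_tadpole _ _ _ hsimp hconn gn cyc_g deg3 deg3_uniq.
pose f (x : 'I_n) := nth x0 t x.
have finj : injective f.
  by move=> x y /eqP; rewrite nth_uniq ?tn ?ltn_ord // => /eqP/val_inj.
(* The parent edges make [f] a homomorphism from the tadpole to [e]; both graphs have degree sum
   [n.*2], so adjacency is also reflected. *)
have fE : forall x y, tadpole g x y = e (f x) (f y).
  apply: hom_arcs_eq => //; last by rewrite deg2n sum_deg_tadpole.
  move=> x y; rewrite tadpole_valE // => /orP[]/eqP xy.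
    by rewrite (proj1 hsimp) /f -[nat_of_ord x]/(val x) xy; apply: te.
  by rewrite /f -[nat_of_ord y]/(val y) xy; apply: te.
have iso : isomorphic e (@tadpole n g).
  have [h fh hf] := injF_bij finj; exists h; split; first by exists f.
  by move=> x y; rewrite fE !hf.
by split=> //; split=> //; rewrite (sombor_isomorphic R _ _ _ hsimp tsimp iso) sombor_tadpole.
Qed.
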